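(* Let $k$ be an odd positive integer, and let $n,j$ be integers with $2\leq j\leq\frac{n}{2}$. Then $C_n^{\{0,2\}}$ can be embedded in $K_k^*$ if and only if $n\leq\binom{k+1}{2}-3$. When $j\geq3$, $C_n^{\{0,j\}}$ can be embedded in $K_k^*$ if and only if $n\leq\binom{k+1}{2}-1$.
   Context: $K_k^*$ denotes the complete graph $K_k$ on vertices $v_0,\dotsc,v_{k-1}$ with a loop $v_iv_i$ added at every vertex. An embedding of a graph $G$ in $K_k^*$ is a map $f:V(G)\to V(K_k^* )$ such that each edge $uv$ of $G$ is sent to the edge $f(u)f(v)$ of $K_k^*$ (a loop if $f(u)=f(v)$), and the induced map $E(G)\to E(K_k^* )$ is injective. For $2\leq j\leq n/2$, $C_n^{\{0,j\}}$ is the cycle $w_0w_1\dotsb w_{n-1}w_0$ on $n$ vertices together with one chord $w_0w_j$ (so it has $n+1$ edges). *)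

(* Defs.v *)
From mathcomp Require Import all_boot.

Set Implicit Arguments.
Unset Strict Implicit.
Unset Printing Implicit Defensive.

(* A finite undirected graph, possibly with loops but without multiple edges,
   is a symmetric relation on a finType.  The edge joining u and v is the set
   [set u; v], so that a loop at u is the singleton [set u]. *)
Definition edges (V : finType) (e : rel V) : {set {set V}} :=
  [set E : {set V} | [exists u, exists v, e u v && (E == [set u; v])]].

(* Since f @: [set u; v] = [set f u; f v], the map on edges induced by f
   is E |-> f @: E. *)
Definition embedding (V W : finType) (e : rel V) (e' : rel W) (f : V -> W)
    : Prop :=
  (forall u v, e u v -> e' (f u) (f v)) /\
  {in edges e &, injective (fun E : {set V} => f @: E)}.

Definition embeddable (V W : finType) (e : rel V) (e' : rel W) : Prop :=
  exists f : V -> W, embedding e e' f.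

Definition complete_graph (k : nat) : rel 'I_k := [rel u v | u != v].
Arguments complete_graph : clear implicits.

Definition add_loops (V : finType) (e : rel V) : rel V :=
  [rel u v | e u v || (u == v)].

Definition Kstar (k : nat) : rel 'I_k := add_loops (complete_graph k).
Arguments Kstar : clear implicits.

(* ordS is the cyclic successor i |-> (i + 1) mod n.  The relation below is
   the cycle graph only for n >= 3. *)
Definition cycle_graph (n : nat) : rel 'I_n :=
  [rel u v | (v == ordS u) || (u == ordS v)].
Arguments cycle_graph : clear implicits.

Definition add_edge (n : nat) (e : rel 'I_n) (a b : nat) : rel 'I_n :=
  [rel u v : 'I_n | [|| e u v, (u == a :> nat) && (v == b :> nat)
                             | (u == b :> nat) && (v == a :> nat)]].

Definition chorded_cycle (n j : nat) : rel 'I_n :=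
  add_edge (cycle_graph n) 0 j.
Arguments chorded_cycle : clear implicits.

(* Main.v *)
(* Necessity counts edges. For j = 2 the images of w0 and w2 differ, since
   otherwise w0w1 and w1w2 would be identified; as all loopless degrees of K_k^*
   are even for k odd, these two vertices have odd degree in the unused part, so
   a single unused edge would have to join them, but the chord uses that edge.

   Sufficiency is by induction from k to k + 2. For j >= 3 the chord goes to the
   loop at 0 and the cycle to two closed trails through 0; for j = 2 the vertices
   w0, w1, w2 go to the triangle 0, 2, 1. Either configuration is lengthened by
   splicing in at 0 a closed trail of new edges through the new vertices k and
   k + 1; its length can be any integer from 3 to 2k + 3 that is not 2 modulo 4. *)
Require Import Defs.
From mathcomp Require Import all_boot zify.

Set Implicit Arguments.
Unset Strict Implicit.
Unset Printing Implicit Defensive.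

(** * Edges of the cycle with a chord *)

(** The index type has n + 1 elements, one per edge. The chord is cut out by the values of its ends,
    which makes sense for all n and j. *)
Definition chorded_edge n j (o : option 'I_n) : {set 'I_n} :=
  if o is Some i then [set i; ordS i]
  else [set u : 'I_n | (u == 0 :> nat) || (u == j :> nat)].

Lemma succn_modn n (i : 'I_n) : i.+1 %% n = if i.+1 == n then 0 else i.+1.
Proof.
case: eqP => [-> | ne]; first exact: modnn.
by rewrite modn_small // ltn_neqAle ltn_ord andbT; apply/eqP.
Qed.

Lemma chorded_edge_chord n j (h0 : 0 < n) (hj : j < n) :
  chorded_edge j None = [set Ordinal h0; Ordinal hj].
Proof. by apply/setP=> u; rewrite !inE. Qed.

Lemma edges_chorded n j : j < n ->
  edges (chorded_cycle n j) = [set chorded_edge j o | o : option 'I_n].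
Proof.
move=> hj; have h0 : 0 < n by exact: leq_ltn_trans hj.
apply/setP=> E; rewrite inE; apply/existsP/imsetP => [[u /existsP[v]] | [o _ ->]].
  case/andP=> /or3P[/orP[]/eqP->|/andP[/eqP u0 /eqP vj]|/andP[/eqP uj /eqP v0]] /eqP->.
  - by exists (Some u).
  - by exists (Some v); rewrite //= setUC.
  - exists None; rewrite // (chorded_edge_chord h0 hj).
    have -> : u = Ordinal h0 by apply: val_inj; exact: u0.
    by have -> : v = Ordinal hj by apply: val_inj; exact: vj.
  - exists None; rewrite // (chorded_edge_chord h0 hj) setUC.
    have -> : u = Ordinal hj by apply: val_inj; exact: uj.
    by have -> : v = Ordinal h0 by apply: val_inj; exact: v0.
case: o => [i|].
  exists i; apply/existsP; exists (ordS i).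
  by rewrite /chorded_cycle /add_edge /cycle_graph /= !eqxx.
rewrite (chorded_edge_chord h0 hj).
exists (Ordinal h0); apply/existsP; exists (Ordinal hj).
by rewrite /chorded_cycle /add_edge /= !eqxx orbT.
Qed.

(** The chord is not a cycle edge because 2 <= j <= n - 2, and the cycle edges are distinct because
    n >= 4. *)
Lemma chorded_edge_inj n j : 2 <= j -> 2 * j <= n ->
  injective (@chorded_edge n j).
Proof.
move=> j2 jn.
have h0 : 0 < n by lia.
have hj : j < n by lia.
have chordF (i : 'I_n) : chorded_edge j (Some i) <> chorded_edge j None.
  move=> /setP E; move: (E i) (E (ordS i)) (E (Ordinal h0)) (E (Ordinal hj)).
  rewrite !inE -!val_eqE /= !succn_modn.
  by have := ltn_ord i; case: (i.+1 =P n); lia.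
case=> [i|] [i'|] //.
- move=> /setP E; congr Some; apply: val_inj; move: (E i) (E (ordS i)) (E i').
  rewrite !inE -!val_eqE /= !succn_modn.
  have := ltn_ord i; have := ltn_ord i'.
  by case: (i.+1 =P n); case: (i'.+1 =P n); lia.
- by move/chordF.
- by move/esym/chordF.
Qed.

(** * Necessity: edge count and parity of degrees *)

Section Necessity.

Variables (k n j : nat) (f : 'I_n -> 'I_k).
Hypotheses (j2 : 2 <= j) (jn : 2 * j <= n).
Hypothesis emb : embedding (chorded_cycle n j) (Kstar k) f.

Let image_edge (o : option 'I_n) := f @: chorded_edge j o.
Let used := [set image_edge o | o : option 'I_n].
Let all_edges := [set E : {set 'I_k} | (#|E| == 1) || (#|E| == 2)].

Lemma image_edge_inj : injective image_edge.
Proof.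
move=> o o' eqf; apply: (chorded_edge_inj j2 jn).
have hj : j < n by lia.
by apply: emb.2; rewrite // (edges_chorded hj) imset_f.
Qed.

Lemma card_used : #|used| = n.+1.
Proof. by rewrite card_imset ?card_option ?card_ord //; exact: image_edge_inj. Qed.

(** Pascal's rule: k loops and ['C(k, 2)] proper edges. *)
Lemma card_all_edges : #|all_edges| = 'C(k + 1, 2).
Proof.
have draws m : #|[set A : {set 'I_k} | #|A| == m]| = 'C(k, m).
  by rewrite card_draws card_ord.
rewrite addn1 binS addnC -!draws -cardsUI.
rewrite [X in _ = _ + #|pred_of_set X|](_ : _ = set0) ?cards0 ?addn0.
  by apply: eq_card => E; rewrite !inE.
by apply/setP=> E; rewrite !inE; case: eqP => // ->.
Qed.

Lemma image_edgeP o : exists a b, image_edge o = [set f a; f b].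
Proof.
have hj : j < n by lia.
have h0 : 0 < n by lia.
case: o => [i|]; rewrite /image_edge.
  by exists i, (ordS i); rewrite /= imsetU1 imset_set1.
by exists (Ordinal h0), (Ordinal hj); rewrite chorded_edge_chord imsetU1 imset_set1.
Qed.

Lemma used_sub : used \subset all_edges.
Proof.
apply/subsetP=> E /imsetP[o _ ->]; have [a [b ->]] := image_edgeP o.
by rewrite inE cards2; case: (f a == f b).
Qed.

Lemma embedding_bound : n + 1 <= 'C(k + 1, 2).
Proof. by rewrite addn1 -card_used -card_all_edges subset_leq_card ?used_sub. Qed.

(** A loop adds 2 to the degree of its vertex, so only proper edges count modulo 2; degree parities
    are sums under [addb]. *)
Let incident (v : 'I_k) (E : {set 'I_k}) := (v \in E) && (#|E| == 2).

Lemma incident_set2 v a b : incident v [set a; b] = (v == a) (+) (v == b).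
Proof.
rewrite /incident !inE cards2.
case: (eqVneq a b) => [->|ab] /=; first by rewrite andbF addbb.
by case: (eqVneq v a) => [->|_]; rewrite ?(negPf ab) ?andbT.
Qed.

Lemma degree_used v (h0 : 0 < n) (hj : j < n) :
  \big[addb/false]_(E in used) incident v E
    = (v == f (Ordinal h0)) (+) (v == f (Ordinal hj)).
Proof.
rewrite big_imset /=; last by move=> o o' _ _; exact: image_edge_inj.
rewrite (bigD1 None) //= (reindex_omap Some id) /=; last by case.
rewrite /image_edge chorded_edge_chord imsetU1 imset_set1 incident_set2.
rewrite (eq_bigl predT); last by move=> i; rewrite /= eqxx.
rewrite (eq_bigr (fun i : 'I_n => (v == f i) (+) (v == f (ordS i)))); last first.
  by move=> i _; rewrite /= imsetU1 imset_set1 incident_set2.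
(* Each cycle position starts one edge and ends one edge. Shifting by [ordS] makes the two sums
   equal, so they cancel and only the ends of the chord remain. *)
rewrite big_split /= (reindex_inj (@ordS_inj n)) /= addbb.
by rewrite addbF.
Qed.

(** One proper edge at v for each of the k - 1 other vertices, an even number. *)
Lemma degree_all_edges v : odd k ->
  \big[addb/false]_(E in all_edges) incident v E = false.
Proof.
move=> kodd; rewrite (bigID (incident v)) /= [X in _ (+) X]big1 ?addbF; last first.
  by move=> E /andP[_ /negPf].
rewrite (eq_bigr (fun=> true)); last by move=> E /andP[].
rewrite (eq_bigl (mem [set [set v; u] | u in [set~ v]])).
  rewrite big_imset /=; last first.
    move=> u u'; rewrite !inE => uv u'v /setP/(_ u).
    by rewrite !inE eqxx orbT (negPf uv) /= => /esym/eqP.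
  rewrite big_const cardsC1 card_ord.
  have -> m : iter m (addb true) false = odd m by elim: m => //= m ->.
  by case: k kodd => //= k' /negPf.
move=> E; rewrite /incident !inE; apply/andP/imsetP.
  case=> _ /andP[vE /cards2P[a [b [ab EE]]]].
  move: vE; rewrite EE !inE => /orP[] /eqP->.
    by exists b; rewrite // !inE eq_sym.
  by exists a; rewrite ?inE // setUC.
case=> u; rewrite !inE => uv ->; rewrite !inE eqxx cards2 /=.
by rewrite (eq_sym v) uv.
Qed.

End Necessity.

Lemma embedding_chord2_bound k n (f : 'I_n -> 'I_k) : odd k -> 4 <= n ->
  embedding (chorded_cycle n 2) (Kstar k) f -> n + 3 <= 'C(k + 1, 2).
Proof.
move=> kodd n4 emb; have jn : 2 * 2 <= n by [].
have h0 : 0 < n by lia.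
have h1 : 1 < n by lia.
have h2 : 2 < n by lia.
have inj := @image_edge_inj k n 2 f isT jn emb.
have f02 : f (Ordinal h0) != f (Ordinal h2).
  apply/negP=> /eqP f02; have := inj (Some (Ordinal h0)) (Some (Ordinal h1)).
  rewrite /= !imsetU1 !imset_set1.
  have -> : ordS (Ordinal h0) = Ordinal h1.
    by apply: val_inj; rewrite /= modn_small.
  have -> : ordS (Ordinal h1) = Ordinal h2.
    by apply: val_inj; rewrite /= modn_small.
  by rewrite f02 setUC => /(_ erefl) [].
rewrite leqNgt -card_all_edges; apply/negP => small.
set K := [set E | _] in small; set U := [set f @: chorded_edge 2 o | o : option 'I_n].
have UK : U \subset K by exact: used_sub.
(* If the bound fails, there are at most n + 2 edges, of which n + 1 are used. *)
have missing : #|K :\: U| <= 1.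
  by rewrite cardsDS // card_used //; lia.
have deg v : \big[addb/false]_(E in K :\: U) ((v \in E) && (#|E| == 2))
    = (v == f (Ordinal h0)) (+) (v == f (Ordinal h2)).
  have := degree_all_edges v kodd; rewrite -/K (big_setID U) /= (setIidPr UK).
  rewrite degree_used // -/U.
  have xorF a b : a (+) b = false -> b = a by case: a b => [] [].
  by move/xorF.
have odd_deg v : \big[addb/false]_(E in K :\: U) ((v \in E) && (#|E| == 2)) ->
    exists E, [/\ E \in K :\: U, v \in E & #|E| = 2].
  move=> dv; case: (pickP [pred E | (E \in K :\: U) && ((v \in E) && (#|E| == 2))]).
    by move=> E /= /and3P[? ? /eqP ?]; exists E.
  move=> no; move: dv; rewrite big1 // => E EM.
  by have := no E; rewrite /= EM.
have [|E [EM vE E2]] := odd_deg (f (Ordinal h0)); first by rewrite deg eqxx (negPf f02).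
have [|E' [E'M vE' _]] := odd_deg (f (Ordinal h2)).
  by rewrite deg eqxx eq_sym (negPf f02).
have EE' : E' = E by move/card_le1_eqP: missing; apply.
move: EM; rewrite inE => /andP[EU _]; case/negP: EU.
apply/imsetP; exists None => //.
rewrite (chorded_edge_chord h0 h2) imsetU1 imset_set1; apply/esym/eqP.
by rewrite eqEcard cards2 f02 E2 leqnn andbT subUset !sub1set vE -EE' vE'.
Qed.

(** * Closed trails as lists of vertices *)

(** With the larger end second, edges at vertices >= k are recognised by the second component alone,
    and layouts can be checked by computation. *)
Definition edge_code (x y : nat) := (minn x y, maxn x y).

(** The closing edge comes first, so entry i is the edge that enters position i. *)
Definition closed_trail_edges (s : seq nat) := pairmap edge_code (last 0 s) s.

(* A closed trail A ++ B in K_k^* whose first vertex is 0, together with the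
   chord from 0 to the first vertex c of B; the chord is a loop when c = 0. *)
Definition layout (k c : nat) (A B : seq nat) :=
  [&& ohead A == Some 0, ohead B == Some c, all (gtn k) (A ++ B)
    & uniq (edge_code 0 c :: closed_trail_edges (A ++ B))].

Definition has_layout k c j l :=
  exists A B, [/\ size A = j, size B = l & layout k c A B].

Lemma layout_cons k c A B : layout k c A B ->
  exists A' B', A = 0 :: A' /\ B = c :: B'.
Proof.
case/and4P; case: A => [//|a A] /eqP[->]; case: B => [//|b B] /eqP[->] _ _.
by exists A, B.
Qed.

Lemma edge_codeC x y : edge_code x y = edge_code y x.
Proof. by rewrite /edge_code minnC maxnC. Qed.

Lemma edge_code_le x y : x <= y -> edge_code x y = (x, y).
Proof. by move=> xy; rewrite /edge_code (minn_idPl xy) (maxn_idPr xy). Qed.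

Lemma edge_code_set2 k (a b c d : 'I_k) : [set a; b] = [set c; d] ->
  edge_code a b = edge_code c d.
Proof.
move=> /setP E; move: (E a) (E b) (E c) (E d); rewrite !inE -!val_eqE /=.
by rewrite /edge_code => *; congr pair; lia.
Qed.

Lemma nth_closed_trail_edges s (i : 'I_(size s)) :
  nth (0, 0) (closed_trail_edges s) (ordS i)
    = edge_code (nth 0 s i) (nth 0 s (ordS i)).
Proof.
rewrite (nth_pairmap 0) ?ltn_ord //= succn_modn; case: eqP => //= e.
by rewrite -nth_last; congr (edge_code (nth 0 s _) _); lia.
Qed.

Lemma has_layout_embeddable k c j l : has_layout k c j l ->
  embeddable (chorded_cycle (j + l) j) (Kstar k).
Proof.
case=> A0 [B0 [<- <- AB]]; have [A [B [eA eB]]] := layout_cons AB.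
rewrite {A0}eA {B0}eB in AB *.
case: k AB => [|k'] /and4P[_ _ /allP small uniqE]; first by have := small 0 isT.
rewrite -size_cat; set s := _ ++ _ in small uniqE *.
have hj : size (0 :: A) < size s by rewrite size_cat /=; lia.
have h0 : 0 < size s by lia.
pose f (i : 'I_(size s)) : 'I_k'.+1 := inord (nth 0 s i).
have fE i : f i = nth 0 s i :> nat by rewrite inordK //; apply: small; rewrite mem_nth.
exists f; split=> [u v _|]; first by rewrite /Kstar /add_loops /complete_graph /= orNb.
(* Position in [L] of the code of each image edge: the chord is at the head, and the edge leaving i
   is the one entering [ordS i], shifted by one. Uniqueness of [L] then gives injectivity. *)
pose pos (o : option 'I_(size s)) : nat := if o is Some i then (ordS i).+1 else 0.
set L := _ :: _ in uniqE.
have sizeL : size L = (size s).+1 by rewrite /= size_pairmap.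
have posP o : exists a b,
    f @: chorded_edge (size (0 :: A)) o = [set f a; f b] /\
    nth (0, 0) L (pos o) = edge_code (f a) (f b).
  case: o => [i|]; last first.
    exists (Ordinal h0), (Ordinal hj).
    rewrite (chorded_edge_chord h0 hj) imsetU1 imset_set1.
    by split=> //; rewrite !fE [nth 0 s (Ordinal hj)]nth_cat ltnn subnn.
  exists i, (ordS i); split; first by rewrite /= imsetU1 imset_set1.
  by rewrite !fE -nth_closed_trail_edges.
move=> E E'; rewrite !(edges_chorded hj).
case/imsetP=> o _ -> /imsetP[o' _ ->] /= eqf.
have [a [b [fo po]]] := posP o; have [a' [b' [fo' po']]] := posP o'.
have pos_lt p : pos p < size L
  by rewrite sizeL; case: p => [i|] //; exact: (ltn_ord (ordS i)).
have /eqP : nth (0, 0) L (pos o) == nth (0, 0) L (pos o').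
  by rewrite po po'; apply/eqP/edge_code_set2; rewrite -fo -fo'.
move/eqP; rewrite nth_uniq // => /eqP; case: (o) (o') => [i|] [i'|] // [] e.
by congr (chorded_edge _ (Some _)); apply: (@ordS_inj _); apply: val_inj.
Qed.

Lemma closed_trail_edges_cat x s y t :
  closed_trail_edges ((x :: s) ++ y :: t)
    = pairmap edge_code (last y t) (x :: s) ++ pairmap edge_code (last x s) (y :: t).
Proof. by rewrite /closed_trail_edges pairmap_cat last_cat. Qed.

(** For c = 0 both blocks are closed trails through 0; exchanging them only permutes the edge
    list. *)
Lemma has_layoutC k j l : has_layout k 0 j l -> has_layout k 0 l j.
Proof.
case=> A0 [B0 [sA sB AB]]; have [A [B [eA eB]]] := layout_cons AB.
rewrite {A0}eA {B0}eB in sA sB AB; case/and4P: AB => _ _ bnd u.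
exists (0 :: B), (0 :: A); split=> //; apply/and4P; split=> //.
  by rewrite all_cat andbC -all_cat.
rewrite !closed_trail_edges_cat in u *; move: u; congr is_true.
by apply/perm_uniq; rewrite perm_cons perm_catC.
Qed.

(** * Splicing in a detour through two new vertices *)

Lemma pairmap_edge_code_lt k x s : x < k -> all (gtn k) s ->
  all (fun p => p.2 < k) (pairmap edge_code x s).
Proof.
elim: s x => //= y s IHs x xk /andP[yk sk].
by rewrite IHs // gtn_max xk yk.
Qed.

(** The old closing edge now leads to the 0 that starts D, and the closing edge of D closes the
    whole trail, so the edge lists simply add up. They are disjoint: larger ends are below k in the
    old list and at least k in the new one. *)
Lemma layout_splice k c A B D : all (gtn k.+2) D -> ohead D = Some 0 ->
    uniq (closed_trail_edges D) -> all (fun p => k <= p.2) (closed_trail_edges D) ->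
  layout k c A B -> layout k.+2 c A (B ++ D).
Proof.
case: D => [|x D] // bD [D0] uD newD AB; rewrite {x}D0 in bD uD newD *.
have [A' [B' [eA eB]]] := layout_cons AB.
rewrite {A}eA {B}eB in AB *; case/and4P: AB => _ _ bnd u.
have old p :
    p \in edge_code 0 c :: closed_trail_edges ((0 :: A') ++ c :: B') -> p.2 < k.
  rewrite in_cons => /predU1P[->|].
    by rewrite /edge_code /= max0n; apply: (allP bnd); rewrite mem_cat mem_head orbT.
  by move: p; apply/allP/pairmap_edge_code_lt => //;
    apply: (allP bnd); exact: (mem_last 0 (A' ++ c :: B')).
have perm : perm_eq (closed_trail_edges ((0 :: A') ++ (c :: B') ++ 0 :: D))
   (closed_trail_edges ((0 :: A') ++ c :: B') ++ closed_trail_edges (0 :: D)).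
  rewrite catA cat_cons closed_trail_edges_cat /closed_trail_edges /=.
  by apply/permP=> P; rewrite /= !count_cat /=; lia.
apply/and4P; split=> //.
  rewrite catA all_cat bD andbT; apply: sub_all bnd => y /=; lia.
rewrite (perm_uniq (_ : perm_eq _ (edge_code 0 c ::
    closed_trail_edges ((0 :: A') ++ c :: B') ++ closed_trail_edges (0 :: D)))).
  rewrite -cat_cons cat_uniq; apply/and3P; split=> //; apply/hasPn=> p pD.
  by apply/negP=> /old; rewrite ltnNge (allP newD p pD).
by rewrite perm_cons.
Qed.

(* A closed trail of length 4q + 3 + d + e from 0 through the new vertices
   k and k + 1: the triangle 0, k, k + 1 with q four-cycles spliced in at k and
   loops at k and k + 1 when d, resp. e, is true. *)
Fixpoint zigzag (k q : nat) : seq nat :=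
  if q is q'.+1 then [:: q'.*2.+1; k.+1; q'.*2.+2; k] ++ zigzag k q' else [::].

Definition detour (k q : nat) (d e : bool) : seq nat :=
  0 :: k :: nseq d k ++ zigzag k q ++ k.+1 :: nseq e k.+1.

Lemma size_detour k q d e : size (detour k q d e) = 4 * q + 3 + d + e.
Proof.
rewrite /= !size_cat /= !size_nseq; suff -> : size (zigzag k q) = 4 * q by lia.
by elim: q => //= q ->; lia.
Qed.

Lemma last_zigzag k q : last k (zigzag k q) = k.
Proof. by elim: q. Qed.

Lemma zigzag_lt k q : q.*2 < k -> all (gtn k.+2) (zigzag k q).
Proof. by elim: q => //= q IHq hq; rewrite IHq /= ?andbT; lia. Qed.

Lemma detour_lt k q d e : q.*2 < k -> all (gtn k.+2) (detour k q d e).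
Proof.
move=> hq; rewrite /= !all_cat zigzag_lt //= !all_nseq /=.
by case: d e => [] []; lia.
Qed.

(** The bound on the smaller end drives the induction, since the next four-cycle passes through the
    old vertices 2q + 1 and 2q + 2. It also keeps the zigzag away from edges at 0 and edges between
    new vertices. *)
Lemma zigzag_edges k q : q.*2 < k ->
  uniq (pairmap edge_code k (zigzag k q))
  /\ all (fun p => (0 < p.1 <= q.*2) && (k <= p.2 <= k.+1))
       (pairmap edge_code k (zigzag k q)).
Proof.
elim: q => //= q IHq hq.
have [|u b] := IHq; first by lia.
have new x y : q.*2 < x ->
    ((x, y) \in pairmap edge_code k (zigzag k q)) = false.
  by move=> hp; apply/negP=> /(allP b) /=; lia.
have h1 : q.*2.+1 < k by lia.
have h2 : q.*2.+2 < k.+1 by lia.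
rewrite (edge_codeC k) (edge_codeC k.+1) !edge_code_le; [|lia..].
split; first by rewrite u !inE !new ?xpair_eqE //=; lia.
apply/and5P; split; rewrite /=; [lia..|].
by apply: sub_all b => p; lia.
Qed.

Lemma detour_edges k q d e : 0 < k -> q.*2 < k ->
  uniq (closed_trail_edges (detour k q d e))
  /\ all (fun p => k <= p.2) (closed_trail_edges (detour k q d e)).
Proof.
move=> k0 hq; have [u b] := zigzag_edges hq.
have lastE (x : nat) (c : bool) : last x (nseq c x) = x by case: c.
rewrite /closed_trail_edges /= last_cat last_cat /= lastE !pairmap_cat lastE /=
  last_zigzag.
have loopE (x : nat) (c : bool) : pairmap edge_code x (nseq c x) = nseq c (x, x).
  by case: c; rewrite //= /edge_code minnn maxnn.
rewrite !loopE.
(* The other detour edges have smaller end 0 or at least k. *)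
have new x y : (x == 0) || (k <= x) ->
    ((x, y) \in pairmap edge_code k (zigzag k q)) = false.
  by move=> hp; apply/negP=> /(allP b) /=; lia.
rewrite (edge_codeC k.+1) !edge_code_le //.
split; last first.
  rewrite /= !all_cat /= !all_nseq /= leqnSn !leqnn !orbT /= andbT leq_maxr.
  by apply: sub_all b => p; lia.
case: d e => [] []; rewrite /= ?(inE, mem_cat, cat_uniq) /=
    ?(inE, mem_cat, cat_uniq) u;
  by rewrite !new ?eqxx ?leqnn ?leqnSn ?orbT //= ?xpair_eqE; lia.
Qed.

Lemma has_layout_widen k c j l : has_layout k c j l -> has_layout k.+2 c j l.
Proof.
move=> [A [B [sA sB /and4P[A0 B0 bnd u]]]]; exists A, B; split=> //.
by apply/and4P; split=> //; apply: sub_all bnd => y /=; lia.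
Qed.

Lemma has_layout_grow k c j l m : odd k -> 3 <= m <= 2 * k + 3 -> m %% 4 != 2 ->
  has_layout k c j l -> has_layout k.+2 c j (l + m).
Proof.
move=> kodd bm m2 [A [B [<- <- AB]]].
(* As m is not 2 modulo 4, r is 0, 1 or 2, the number of loops to add. As k is odd, m <= 2k + 3
   gives 2q <= k - 1; m = 2k + 3 uses every new edge. *)
pose q := (m - 3) %/ 4; pose r := (m - 3) %% 4.
have k0 : 0 < k by lia.
have hq : q.*2 < k by rewrite /q; lia.
have [u b] := detour_edges (0 < r) (1 < r) k0 hq.
exists A, (B ++ detour k q (0 < r) (1 < r)); rewrite size_cat size_detour; split=> //.
  by congr (_ + _); rewrite /q /r; lia.
by apply: layout_splice AB => //; exact: detour_lt.
Qed.

(** * Base cases for k = 5 and k = 7 *)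

(* The three tables below were found by computer search. *)
Definition triangle5 : seq (seq nat * seq nat) := [::
  ([:: 0; 2], [:: 1; 3]);
  ([:: 0; 2], [:: 1; 3; 0]);
  ([:: 0; 2], [:: 1; 3; 3; 0]);
  ([:: 0; 2], [:: 1; 4; 2; 3; 0]);
  ([:: 0; 2], [:: 1; 3; 2; 4; 4; 0]);
  ([:: 0; 2], [:: 1; 1; 3; 3; 4; 4; 0]);
  ([:: 0; 2], [:: 1; 1; 4; 3; 3; 2; 2; 4]);
  ([:: 0; 2], [:: 1; 4; 2; 2; 3; 3; 4; 4; 0]);
  ([:: 0; 2], [:: 1; 1; 4; 3; 3; 2; 2; 4; 4; 0])].

Definition loops5 : seq (seq nat * seq nat) := [::
  ([:: 0; 2; 3], [:: 0; 4; 1]);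
  ([:: 0; 3; 2], [:: 0; 1; 3; 4]);
  ([:: 0; 3; 4], [:: 0; 2; 3; 3; 1]);
  ([:: 0; 3; 1], [:: 0; 4; 1; 1; 2; 2]);
  ([:: 0; 2; 4], [:: 0; 1; 2; 3; 1; 4; 3]);
  ([:: 0; 2; 3], [:: 0; 1; 2; 2; 4; 1; 3; 4]);
  ([:: 0; 2; 3], [:: 0; 1; 3; 4; 2; 1; 1; 4; 4]);
  ([:: 0; 1; 2], [:: 0; 3; 3; 1; 1; 4; 2; 2; 3; 4]);
  ([:: 0; 1; 3], [:: 0; 2; 2; 4; 1; 1; 2; 3; 3; 4; 4]);
  ([:: 0; 1; 2; 3], [:: 0; 2; 2; 4]);
  ([:: 0; 4; 1; 1], [:: 0; 2; 4; 3; 3]);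
  ([:: 0; 4; 2; 2], [:: 0; 1; 1; 4; 3; 3]);
  ([:: 0; 3; 3; 1], [:: 0; 4; 4; 1; 1; 2; 2]);
  ([:: 0; 1; 3; 3], [:: 0; 4; 2; 1; 4; 3; 2; 2]);
  ([:: 0; 3; 2; 2], [:: 0; 1; 3; 3; 4; 1; 2; 4; 4]);
  ([:: 0; 3; 3; 1], [:: 0; 2; 2; 3; 4; 1; 1; 2; 4; 4]);
  ([:: 0; 2; 1; 4; 4], [:: 0; 1; 1; 3; 3]);
  ([:: 0; 4; 3; 3; 2], [:: 0; 3; 1; 4; 2; 1]);
  ([:: 0; 2; 3; 4; 4], [:: 0; 3; 3; 1; 4; 2; 1]);
  ([:: 0; 4; 1; 1; 2], [:: 0; 1; 3; 2; 2; 4; 4; 3]);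
  ([:: 0; 4; 2; 1; 3], [:: 0; 1; 1; 4; 4; 3; 3; 2; 2]);
  ([:: 0; 1; 2; 2; 4; 4], [:: 0; 2; 3; 4; 1; 3]);
  ([:: 0; 1; 4; 2; 3; 3], [:: 0; 4; 4; 3; 1; 2; 2]);
  ([:: 0; 3; 2; 1; 4; 4], [:: 0; 2; 2; 4; 3; 3; 1; 1]);
  ([:: 0; 2; 3; 4; 2; 2; 1], [:: 0; 4; 4; 1; 1; 3; 3])].

(* These include the lengths for k = 7 that the induction step does not reach
   from k = 5. *)
Definition loops7 : seq (seq nat * seq nat) := [::
  ([:: 0; 3; 2; 6; 6; 1; 1; 2; 5; 3; 4], [:: 0; 2; 2; 4; 4; 5; 5; 6; 4; 1; 5]);
  ([:: 0; 3; 6; 0; 5; 6; 4; 5; 1; 3; 4], [:: 0; 2; 3; 3; 5; 2; 1; 4; 2; 6; 6; 1]);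
  ([:: 0; 3; 2; 2; 1; 1; 0; 2; 6; 4; 4], [:: 0; 5; 5; 3; 3; 4; 5; 2; 4; 1; 5; 6; 6]);
  ([:: 0; 4; 3; 3; 5; 0; 2; 2; 1; 6; 6], [:: 0; 1; 1; 3; 6; 4; 1; 5; 6; 2; 5; 4; 2; 3]);
  ([:: 0; 6; 1; 0; 3; 1; 2; 6; 6; 4; 4], [:: 0; 5; 6; 3; 4; 1; 1; 5; 4; 2; 2; 5; 5; 3; 2]);
  ([:: 0; 5; 2; 1; 6; 4; 3; 6; 6; 0; 2; 3], [:: 0; 4; 1; 1; 3; 5; 5; 6; 2; 4; 5; 1]);
  ([:: 0; 5; 4; 6; 3; 3; 5; 6; 6; 2; 4; 4], [:: 0; 6; 1; 2; 5; 1; 4; 3; 0; 1; 1; 3; 2]);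
  ([:: 0; 3; 1; 4; 2; 2; 1; 5; 3; 3; 6; 4], [:: 0; 1; 1; 6; 0; 2; 3; 4; 5; 2; 6; 6; 5; 5]);
  ([:: 0; 3; 4; 5; 6; 6; 4; 4; 2; 0; 6; 1], [:: 0; 4; 1; 1; 5; 2; 2; 6; 3; 1; 2; 3; 3; 5; 5]);
  ([:: 0; 6; 5; 4; 0; 5; 2; 3; 1; 1; 4; 3; 3], [:: 0; 2; 1; 5; 3; 6; 2; 2; 4; 4; 6; 6; 1]);
  ([:: 0; 3; 3; 4; 0; 5; 4; 2; 5; 3; 2; 6; 6], [:: 0; 2; 2; 1; 1; 3; 6; 5; 5; 1; 4; 4; 6; 1])].

Lemma has_layout_table k c table N (R : rel nat) :
    all (fun p => layout k c p.1 p.2) table ->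
    all (fun j => all (fun l => R j l ==>
      ((j, l) \in [seq (size p.1, size p.2) | p <- table])) (iota 0 N)) (iota 0 N) ->
  forall j l, j < N -> l < N -> R j l -> has_layout k c j l.
Proof.
move=> ok cover j l jN lN Rjl.
have /mapP[[A B] inT [-> ->]] : (j, l) \in [seq (size p.1, size p.2) | p <- table].
  move/allP/(_ j): cover; rewrite mem_iota jN => /(_ isT)/allP/(_ l).
  by rewrite mem_iota lN Rjl => /(_ isT).
by exists A, B; split=> //; exact: (allP ok _ inT).
Qed.

Lemma has_layout_triangle5 l : 2 <= l <= 10 -> has_layout 5 1 2 l.
Proof.
move=> bl; apply: (@has_layout_table 5 1 triangle5 11 [rel j l | (j == 2) && (2 <= l)]);
  by [vm_compute | vm_compute | lia | lia | move=> /=; lia].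
Qed.

Lemma has_layout_loops5 j l : 3 <= j <= l -> j + l <= 14 -> has_layout 5 0 j l.
Proof.
move=> bj bl;
(* From j >= 3 and j + l <= 14, l is at most 11. *)
apply: (@has_layout_table 5 0 loops5 12 [rel j l | (3 <= j <= l) && (j + l <= 14)]);
  by [vm_compute | vm_compute | lia | lia | move=> /=; lia].
Qed.

Lemma has_layout_loops7 j l : 11 <= j <= l -> l <= 15 -> j + l <= 27 ->
  has_layout 7 0 j l.
Proof.
move=> bj b15 bl.
apply: (@has_layout_table 7 0 loops7 16 [rel j l | (11 <= j <= l) && (j + l <= 27)]);
  by [vm_compute | vm_compute | lia | lia | move=> /=; lia].
Qed.

(** * Induction on odd k >= 5 *)

Lemma tri_odd m : 'C(2 * m + 5 + 1, 2) = (m + 3) * (2 * m + 5).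
Proof. by rewrite bin2 -[RHS]doubleK; congr _./2; lia. Qed.

Lemma has_layout_triangle m l : 2 <= l -> l + 5 <= 'C(2 * m + 5 + 1, 2) ->
  has_layout (2 * m + 5) 1 2 l.
Proof.
rewrite tri_odd; elim: m l => [|m IHm] l l2 hl.
  by apply: has_layout_triangle5; lia.
have eqk : 2 * m.+1 + 5 = (2 * m + 5).+2 by lia.
have [small|large] := leqP (l + 5) ((m + 3) * (2 * m + 5)).
  by rewrite eqk; apply/has_layout_widen/IHm.
(* c is the detour length. For long B all 2k + 3 new edges are used, with k = 2m + 5; otherwise B
   shrinks to length 2, or to 3 when l - 2 is 2 modulo 4. *)
have [c [c3 ck c4 cl clm]] : exists c,
    [/\ 3 <= c, c <= 2 * (2 * m + 5) + 3, c %% 4 != 2,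
    c + 2 <= l & l + 5 <= (m + 3) * (2 * m + 5) + c].
  have [big|low] := leqP (2 * (2 * m + 5) + 5) l.
    by exists (2 * (2 * m + 5) + 3); split; lia.
  have [e|ne] := eqVneq ((l - 2) %% 4) 2.
    by exists (l - 3); split; nia.
  by exists (l - 2); split; nia.
rewrite eqk -(subnK (leq_trans (leq_addr 2 c) cl)).
by apply: has_layout_grow; [lia|lia|lia|apply: IHm; lia].
Qed.

Lemma has_layout_loop m j l : 3 <= j -> 3 <= l -> j + l < 'C(2 * m + 5 + 1, 2) ->
  has_layout (2 * m + 5) 0 j l.
Proof.
rewrite tri_odd; elim: m j l => [|m IHm] j l j3 l3 hjl;
  wlog jl : j l j3 l3 hjl / j <= l.
- move=> th; have [jl|/ltnW lj] := leqP j l; first exact: th.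
  by apply/has_layoutC/th; rewrite // addnC.
- by apply: has_layout_loops5; lia.
- move=> th; have [jl|/ltnW lj] := leqP j l; first exact: th.
  by apply/has_layoutC/th; rewrite // addnC.
have eqk : 2 * m.+1 + 5 = (2 * m + 5).+2 by lia.
have [small|large] := leqP ((m + 3) * (2 * m + 5)) (j + l); last first.
  by rewrite eqk; apply/has_layout_widen/IHm.
(* For k = 7, l >= 16 allows the full detour of length 13, and j <= 10 leaves room at k = 5 for a
   second trail of length 3 or 4; the table covers the rest. *)
have [/and3P[/eqP m0 j11 l15]|generic] := boolP [&& m == 0, 11 <= j & l <= 15].
  by rewrite m0; apply: has_layout_loops7; lia.
have [c [c3 ck c4 cl cjl]] : exists c,
    [/\ 3 <= c, c <= 2 * (2 * m + 5) + 3, c %% 4 != 2,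
    c + 3 <= l & j + l < (m + 3) * (2 * m + 5) + c].
  have [big|low] := leqP (2 * (2 * m + 5) + 6) l.
    by exists (2 * (2 * m + 5) + 3); split; lia.
  (* The second trail shrinks to length 3 or 4, so j + 4 must stay below the binomial for 2m + 5. *)
  have jm : j + 5 <= (m + 3) * (2 * m + 5) by nia.
  have l8 : 8 <= l by nia.
  have [e|ne] := eqVneq ((l - 3) %% 4) 2.
    by exists (l - 4); split; lia.
  by exists (l - 3); split; lia.
rewrite eqk -(subnK (leq_trans (leq_addr 3 c) cl)).
by apply: has_layout_grow; [lia|lia|lia|apply: IHm; lia].
Qed.

Theorem theorem2p7 (k n j : nat) (hk : odd k) (hj : 2 <= j)
    (hjn : 2 * j <= n) :
  (embeddable (chorded_cycle n 2) (Kstar k) <-> n + 3 <= 'C(k + 1, 2)) /\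
  (3 <= j ->
     (embeddable (chorded_cycle n j) (Kstar k) <-> n + 1 <= 'C(k + 1, 2))).
Proof.
have n4 : 4 <= n by lia.
have [k5|k3] := leqP 5 k; last first.
  (* For k = 1 and k = 3 both sides fail, as n >= 4, and n >= 6 when j >= 3. *)
  have C6 : 'C(k + 1, 2) <= 6 by case: k hk k3 => [|[|[|[|[]]]]].
  split=> [|j3]; split; last 1 first.
  - by lia.
  - by case=> f; apply: embedding_chord2_bound.
  - by lia.
  - by case=> f; apply: embedding_bound.
have -> : k = 2 * (k - 5)./2 + 5 by lia.
set m := (k - 5)./2; have modd : odd (2 * m + 5) by lia.
split=> [|j3]; split.
- by case=> f; apply: embedding_chord2_bound.
- move=> hn; rewrite -(subnKC (_ : 2 <= n)); last by lia.
  by apply/has_layout_embeddable/has_layout_triangle; lia.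
- by case=> f; apply: embedding_bound.
- move=> hn; rewrite -(subnKC (_ : j <= n)); last by lia.
  by apply/has_layout_embeddable/has_layout_loop; lia.
Qed.
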